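(* Let $\mathbb{R}$ be the ordered field of real numbers (a model of $RCF$), let $\bar M$ be a saturated elementary extension, and let $G=S^1\times(\mathbb{R},+)^2$, where $S^1=\{(x,y):x^2+y^2=1\}$ is the circle group. Then in $S_G(\mathbb{R})$, and also in $S_G(\bar M)$, the set of weakly generic types properly contains the set of almost periodic types.
   Context: For a model $N$ over which $G$ is defined, $G(N)$ acts on $S_G(N)$ by left translation. A type is almost periodic if the closure of its $G(N)$-orbit is a minimal closed $G(N)$-invariant subset of $S_G(N)$. A definable $Y\subseteq G(N)$ is left generic if finitely many left $G(N)$-translates cover $G(N)$; it is weakly generic if for some finite union $Z$ of left translates of $Y$, $G(N)\setminus Z$ is not left generic. A type is weakly generic if every formula in it is weakly generic. *)

(* Defs.v *)
From HB Require Import structures.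
From mathcomp Require Import all_boot all_order all_algebra.
From mathcomp Require Import all_classical all_reals topology.
From mathcomp Require Import ordered_qelim.
From mathcomp Require Import ring.

Set Implicit Arguments.
Unset Strict Implicit.
Unset Printing Implicit Defensive.

Import Order.TTheory GRing.Theory Num.Theory.

Local Open Scope classical_set_scope.
Local Open Scope ring_scope.

(* [ord.formula A] is the type of formulas in the language of ordered rings
   (with inverse, which is definable) with parameters in [A]; its semantics
   [ord.holds e f] reads the variable 'X_i as e`_i. *)

Section Syntax.
Variable T : Type.

Fixpoint term_fv (t : GRing.term T) : seq nat :=
  match t with
  | GRing.Var i => [:: i]
  | GRing.Const _ => [::]
  | GRing.NatConst _ => [::]
  | GRing.Add t1 t2 => term_fv t1 ++ term_fv t2
  | GRing.Opp t1 => term_fv t1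
  | GRing.NatMul t1 _ => term_fv t1
  | GRing.Mul t1 t2 => term_fv t1 ++ term_fv t2
  | GRing.Inv t1 => term_fv t1
  | GRing.Exp t1 _ => term_fv t1
  end.

Fixpoint fv (f : ord.formula T) : seq nat :=
  match f with
  | ord.Bool _ => [::]
  | ord.Equal t1 t2 => term_fv t1 ++ term_fv t2
  | ord.Lt t1 t2 => term_fv t1 ++ term_fv t2
  | ord.Le t1 t2 => term_fv t1 ++ term_fv t2
  | ord.Unit t1 => term_fv t1
  | ord.And f1 f2 => fv f1 ++ fv f2
  | ord.Or f1 f2 => fv f1 ++ fv f2
  | ord.Implies f1 f2 => fv f1 ++ fv f2
  | ord.Not f1 => fv f1
  | ord.Exists i f1 => [seq j <- fv f1 | j != i]
  | ord.Forall i f1 => [seq j <- fv f1 | j != i]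
  end.

Definition formulas_in (n : nat) : set (ord.formula T) :=
  [set f | forall i, i \in fv f -> (i < n)%N].

Notation zero := (GRing.NatConst T 0%N).

Fixpoint term_subst (ts : seq (GRing.term T)) (t : GRing.term T) :=
  match t with
  | GRing.Var i => nth zero ts i
  | GRing.Const c => GRing.Const c
  | GRing.NatConst n => GRing.NatConst T n
  | GRing.Add t1 t2 => GRing.Add (term_subst ts t1) (term_subst ts t2)
  | GRing.Opp t1 => GRing.Opp (term_subst ts t1)
  | GRing.NatMul t1 n => GRing.NatMul (term_subst ts t1) n
  | GRing.Mul t1 t2 => GRing.Mul (term_subst ts t1) (term_subst ts t2)
  | GRing.Inv t1 => GRing.Inv (term_subst ts t1)
  | GRing.Exp t1 n => GRing.Exp (term_subst ts t1) n
  end.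

(* Simultaneous substitution of the terms [ts] for 'X_0, 'X_1, ...
   It avoids capture provided that the variables of [ts] are all < m:
   bound variables are renamed to 'X_m, 'X_m.+1, ... *)
Fixpoint subst (ts : seq (GRing.term T)) (m : nat) (f : ord.formula T) :=
  match f with
  | ord.Bool b => ord.Bool b
  | ord.Equal t1 t2 => ord.Equal (term_subst ts t1) (term_subst ts t2)
  | ord.Lt t1 t2 => ord.Lt (term_subst ts t1) (term_subst ts t2)
  | ord.Le t1 t2 => ord.Le (term_subst ts t1) (term_subst ts t2)
  | ord.Unit t1 => ord.Unit (term_subst ts t1)
  | ord.And f1 f2 => ord.And (subst ts m f1) (subst ts m f2)
  | ord.Or f1 f2 => ord.Or (subst ts m f1) (subst ts m f2)
  | ord.Implies f1 f2 => ord.Implies (subst ts m f1) (subst ts m f2)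
  | ord.Not f1 => ord.Not (subst ts m f1)
  | ord.Exists i f1 =>
      ord.Exists m (subst (set_nth zero ts i (GRing.Var T m)) m.+1 f1)
  | ord.Forall i f1 =>
      ord.Forall m (subst (set_nth zero ts i (GRing.Var T m)) m.+1 f1)
  end.

Lemma term_fv_subst ts t j : j \in term_fv (term_subst ts t) ->
  exists2 k, k \in term_fv t & j \in term_fv (nth zero ts k).
Proof.
elim: t => //=.
- by move=> i ji; exists i; rewrite ?inE.
- move=> t1 IH1 t2 IH2; rewrite mem_cat => /orP[/IH1|/IH2] [k kt jk];
    by exists k; rewrite // mem_cat kt ?orbT.
- move=> t1 IH1 t2 IH2; rewrite mem_cat => /orP[/IH1|/IH2] [k kt jk];
    by exists k; rewrite // mem_cat kt ?orbT.
Qed.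

Lemma fv_subst ts m f j : j \in fv (subst ts m f) ->
  exists2 k, k \in fv f & j \in term_fv (nth zero ts k).
Proof.
have qf t1 t2 us : j \in term_fv (term_subst us t1) ++ term_fv (term_subst us t2) ->
    exists2 k, k \in term_fv t1 ++ term_fv t2 & j \in term_fv (nth zero us k).
  by rewrite mem_cat => /orP[] /term_fv_subst [k kt jk];
    exists k; rewrite // mem_cat kt ?orbT.
have bin f1 f2 us n : (forall us n, j \in fv (subst us n f1) ->
      exists2 k, k \in fv f1 & j \in term_fv (nth zero us k)) ->
    (forall us n, j \in fv (subst us n f2) ->
      exists2 k, k \in fv f2 & j \in term_fv (nth zero us k)) ->
    j \in fv (subst us n f1) ++ fv (subst us n f2) ->
    exists2 k, k \in fv f1 ++ fv f2 & j \in term_fv (nth zero us k).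
  move=> IH1 IH2; rewrite mem_cat => /orP[/IH1|/IH2] [k kt jk];
    by exists k; rewrite // mem_cat kt ?orbT.
have quant i f1 us n : (forall us n, j \in fv (subst us n f1) ->
      exists2 k, k \in fv f1 & j \in term_fv (nth zero us k)) ->
    j \in [seq l <- fv (subst (set_nth zero us i (GRing.Var T n)) n.+1 f1) | l != n] ->
    exists2 k, k \in [seq l <- fv f1 | l != i] & j \in term_fv (nth zero us k).
  move=> IH; rewrite mem_filter => /andP[jn /IH[k kf]].
  rewrite nth_set_nth /=; case: eqP => [_|/eqP ki jk].
    by rewrite inE (negPf jn).
  by exists k; rewrite // mem_filter ki.
elim: f ts m => //=.
- by move=> t1 t2 ts m; apply: qf.
- by move=> t1 t2 ts m; apply: qf.
- by move=> t1 t2 ts m; apply: qf.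
- by move=> t ts m /term_fv_subst.
- by move=> f1 IH1 f2 IH2 ts m; apply: bin.
- by move=> f1 IH1 f2 IH2 ts m; apply: bin.
- by move=> f1 IH1 f2 IH2 ts m; apply: bin.
- by move=> i f1 IH ts m; apply: quant.
- by move=> i f1 IH ts m; apply: quant.
Qed.

End Syntax.

Section MapParameters.
Variables (T U : Type) (h : T -> U).

Fixpoint map_term (t : GRing.term T) : GRing.term U :=
  match t with
  | GRing.Var i => GRing.Var U i
  | GRing.Const c => GRing.Const (h c)
  | GRing.NatConst n => GRing.NatConst U n
  | GRing.Add t1 t2 => GRing.Add (map_term t1) (map_term t2)
  | GRing.Opp t1 => GRing.Opp (map_term t1)
  | GRing.NatMul t1 n => GRing.NatMul (map_term t1) n
  | GRing.Mul t1 t2 => GRing.Mul (map_term t1) (map_term t2)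
  | GRing.Inv t1 => GRing.Inv (map_term t1)
  | GRing.Exp t1 n => GRing.Exp (map_term t1) n
  end.

Fixpoint map_formula (f : ord.formula T) : ord.formula U :=
  match f with
  | ord.Bool b => ord.Bool b
  | ord.Equal t1 t2 => ord.Equal (map_term t1) (map_term t2)
  | ord.Lt t1 t2 => ord.Lt (map_term t1) (map_term t2)
  | ord.Le t1 t2 => ord.Le (map_term t1) (map_term t2)
  | ord.Unit t1 => ord.Unit (map_term t1)
  | ord.And f1 f2 => ord.And (map_formula f1) (map_formula f2)
  | ord.Or f1 f2 => ord.Or (map_formula f1) (map_formula f2)
  | ord.Implies f1 f2 => ord.Implies (map_formula f1) (map_formula f2)
  | ord.Not f1 => ord.Not (map_formula f1)
  | ord.Exists i f1 => ord.Exists i (map_formula f1)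
  | ord.Forall i f1 => ord.Forall i (map_formula f1)
  end.

End MapParameters.

Lemma holds_subst (N : realDomainType) (ts : seq (GRing.term N)) m f e :
  (forall k, (GRing.ub_var (nth (GRing.NatConst N 0%N) ts k) <= m)%N) ->
  ord.holds e (subst ts m f) <-> ord.holds [seq GRing.eval e t | t <- ts] f.
Proof.
have nthE (us : seq (GRing.term N)) (e' : seq N) i :
    nth 0 [seq GRing.eval e' t | t <- us] i
    = GRing.eval e' (nth (GRing.NatConst N 0%N) us i).
  case: (ltnP i (size us)) => hi; first by rewrite (nth_map (GRing.NatConst N 0%N)).
  by rewrite !nth_default ?size_map.
have evalE (us : seq (GRing.term N)) (e' : seq N) t : GRing.eval e' (term_subst us t)
    = GRing.eval [seq GRing.eval e' t | t <- us] t.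
  elim: t => //=; try by move=> t1 -> t2 ->.
  - by move=> t1 ->.
  - by move=> t1 -> n.
  - by move=> t1 ->.
  - by move=> t1 -> n.
have eval_fresh (e' : seq N) n x t : (GRing.ub_var t <= n)%N ->
    GRing.eval (set_nth 0 e' n x) t = GRing.eval e' t.
  elim: t => //=.
  - by move=> i; rewrite nth_set_nth /=; case: eqP => // ->; rewrite ltnn.
  - by move=> t1 IH1 t2 IH2; rewrite geq_max => /andP[/IH1-> /IH2->].
  - by move=> t1 IH /IH->.
  - by move=> t1 IH n1 /IH->.
  - by move=> t1 IH1 t2 IH2; rewrite geq_max => /andP[/IH1-> /IH2->].
  - by move=> t1 IH /IH->.
  - by move=> t1 IH n1 /IH->.
have step (us : seq (GRing.term N)) n i :
    (forall k, (GRing.ub_var (nth (GRing.NatConst N 0%N) us k) <= n)%N) ->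
    forall k, (GRing.ub_var (nth (GRing.NatConst N 0%N)
      (set_nth (GRing.NatConst N 0%N) us i (GRing.Var N n)) k) <= n.+1)%N.
  move=> H k; rewrite nth_set_nth /=; case: eqP => // _.
  exact: leq_trans (H k) _.
have env (us : seq (GRing.term N)) n i (e' : seq N) x :
    (forall k, (GRing.ub_var (nth (GRing.NatConst N 0%N) us k) <= n)%N) ->
    GRing.same_env
      [seq GRing.eval (set_nth 0 e' n x) t
         | t <- set_nth (GRing.NatConst N 0%N) us i (GRing.Var N n)]
      (set_nth 0 [seq GRing.eval e' t | t <- us] i x).
  move=> H k; rewrite nthE !nth_set_nth /=; case: eqP => _ /=.
    by rewrite nth_set_nth /= eqxx.
  by rewrite nthE eval_fresh.
have sym (e1 e2 : seq N) : GRing.same_env e1 e2 -> GRing.same_env e2 e1.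
  by move=> E k; rewrite E.
elim: f ts m e => //=; try by move=> *; rewrite !evalE.
- by move=> f1 IH1 f2 IH2 ts m e H; rewrite IH1 ?IH2.
- by move=> f1 IH1 f2 IH2 ts m e H; rewrite IH1 ?IH2.
- by move=> f1 IH1 f2 IH2 ts m e H; rewrite IH1 ?IH2.
- by move=> f1 IH1 ts m e H; rewrite IH1.
- move=> i f1 IH ts m e H; split=> -[x hx]; exists x.
    by move: hx; rewrite IH; [apply/ord.eq_holds/env|exact: step].
  rewrite IH; last exact: step.
  by apply: ord.eq_holds hx; apply/sym/env.
- move=> i f1 IH ts m e H; split=> hx x; move: (hx x).
    by rewrite IH; [apply/ord.eq_holds/env|exact: step].
  rewrite IH; last exact: step.
  by apply: ord.eq_holds; apply/sym/env.
Qed.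

(* The group G = S^1 x (N,+)^2, as a definable subset of N^4. *)

Section Group.
Variable N : rcfType.

Definition circle : Type := {z : N * N | z.1 ^+ 2 + z.2 ^+ 2 == 1}.
HB.instance Definition _ := Choice.on circle.

Definition G : Type := (circle * (N * N))%type.
HB.instance Definition _ := Choice.on G.

Fact circle_one_subproof : (1 : N) ^+ 2 + 0 ^+ 2 == 1.
Proof. by rewrite expr1n expr0n addr0. Qed.

Fact circle_inv_subproof (z : circle) :
  (val z).1 ^+ 2 + (- (val z).2) ^+ 2 == 1.
Proof. by rewrite sqrrN (valP z). Qed.

Fact circle_mul_subproof (z w : circle) :
  ((val z).1 * (val w).1 - (val z).2 * (val w).2) ^+ 2
    + ((val z).1 * (val w).2 + (val z).2 * (val w).1) ^+ 2 == 1.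
Proof.
case: z w => [[a b] /= /eqP ab] [[c d] /= /eqP cd]; apply/eqP.
by rewrite -[1]mulr1 -{1}ab -cd; ring.
Qed.

Definition circle_one : circle := exist _ (1, 0) circle_one_subproof.
Definition circle_inv (z : circle) : circle :=
  exist _ ((val z).1, - (val z).2) (circle_inv_subproof z).
Definition circle_mul (z w : circle) : circle :=
  exist _ ((val z).1 * (val w).1 - (val z).2 * (val w).2,
           (val z).1 * (val w).2 + (val z).2 * (val w).1)
    (circle_mul_subproof z w).

Definition G_one : G := (circle_one, (0, 0)).
Definition G_inv (g : G) : G := (circle_inv g.1, (- g.2.1, - g.2.2)).
Definition G_mul (g h : G) : G :=
  (circle_mul g.1 h.1, (g.2.1 + h.2.1, g.2.2 + h.2.2)).

Fact G_mulA : associative G_mul.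
Proof.
move=> [[[a b] p] [u v]] [[[c d] q] [u' v']] [[[c' d'] q'] [u'' v'']].
by congr (_, (_, _)); [apply: val_inj; congr (_, _)| |] => /=; ring.
Qed.

Fact G_mulC : commutative G_mul.
Proof.
move=> [[[a b] p] [u v]] [[[c d] q] [u' v']].
by congr (_, (_, _)); [apply: val_inj; congr (_, _)| |] => /=; ring.
Qed.

Fact G_mul1 : left_id G_one G_mul.
Proof.
move=> [[[a b] p] [u v]].
by congr (_, (_, _)); [apply: val_inj; congr (_, _)| |] => /=; ring.
Qed.

Fact G_mulV : left_inverse G_one G_inv G_mul.
Proof.
move=> [[[a b] p] [u v]]; have /= /eqP ab := p.
congr (_, (_, _)); [apply: val_inj; congr (_, _)| |] => /=; try by ring.
by rewrite -ab; ring.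
Qed.

Fact G_mul1r : right_id G_one G_mul.
Proof. by move=> g; rewrite G_mulC G_mul1. Qed.

Fact G_mulVr : right_inverse G_one G_inv G_mul.
Proof. by move=> g; rewrite G_mulC G_mulV. Qed.

HB.instance Definition _ :=
  isGroup.Build G G_mulA G_mul1 G_mul1r G_mulV G_mulVr.

Definition coords (g : G) : 4.-tuple N :=
  [tuple (val g.1).1; (val g.1).2; g.2.1; g.2.2].

Definition G_formula : ord.formula N :=
  ord.Equal ('X_0 ^+ 2 + 'X_1 ^+ 2)%T 1%T.

Lemma holds_G (x : 4.-tuple N) :
  ord.holds x G_formula <-> exists g : G, x = coords g.
Proof.
case: x => -[|a [|b [|c [|d [|? ?]]]]] //= ?.
split=> [/eqP p|[g [-> -> _ _]]]; last exact/eqP/(valP g.1).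
by exists (exist _ (a, b) p, (c, d)); apply: val_inj.
Qed.

(* The coordinates of g * x, where x is the tuple of variables. *)
Definition lmul_terms (g : G) : seq (GRing.term N) :=
  let: (z, (u, v)) := g in
  let a := ((val z).1%:T)%T in let b := ((val z).2%:T)%T in
  [:: a * 'X_0 - b * 'X_1; a * 'X_1 + b * 'X_0; u%:T + 'X_2; v%:T + 'X_3]%T.

Definition lmul_formula (g : G) (f : ord.formula N) : ord.formula N :=
  subst (lmul_terms g) 4 f.

Lemma holds_lmul (g x : G) f :
  ord.holds (coords x) (lmul_formula g f) <-> ord.holds (coords (g * x)%g) f.
Proof.
rewrite /lmul_formula holds_subst; first by case: g => z [u v].
by case: g => z [u v] [|[|[|[|[|k]]]]].
Qed.

Lemma lmul_formula_in (g : G) f :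
  formulas_in 4 f -> formulas_in 4 (lmul_formula g f).
Proof.
move=> _ j /fv_subst [k _]; case: g => z [u v].
by case: k => [|[|[|[|[|k]]]]] //=; rewrite !inE;
  do ?[case/orP]; move=> /eqP->.
Qed.

End Group.

Section Types.
Variable N : rcfType.

Definition finitely_satisfiable (n : nat) (p : set (ord.formula N)) :=
  forall F : set (ord.formula N), finite_set F -> F `<=` p ->
    exists x : n.-tuple N, forall f, F f -> ord.holds x f.

(* S_G(N): the complete types over N containing the formula defining G.
   A set of formulas with parameters in N is consistent with the elementary
   diagram of N iff it is finitely satisfiable in N. *)
Record SG := MkSG {
  fmls :> set (ord.formula N);
  fmls_in : fmls `<=` formulas_in 4;
  fmls_consistent : finitely_satisfiable 4 fmls;
  fmls_complete : forall f, formulas_in 4 f -> fmls f \/ fmls (ord.Not f);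
  fmls_G : fmls (G_formula N) }.

HB.instance Definition _ := gen_eqMixin SG.
HB.instance Definition _ := gen_choiceMixin SG.

Lemma SG_closed (p : SG) (F : set (ord.formula N)) f : finite_set F ->
    F `<=` p -> formulas_in 4 f ->
    (forall x : G N, (forall h, F h -> ord.holds (coords x) h) ->
       ord.holds (coords x) f) ->
  fmls p f.
Proof.
move=> finF Fp f4 Ff; have [//|pNf] := fmls_complete p f4.
have [||x xP] := @fmls_consistent p (F `|` [set ord.Not f; G_formula N]).
- by rewrite finite_setU; split=> //; exact: finite_set2.
- by move=> h [/Fp//|[->//|->]]; exact: fmls_G.
have /holds_G[g gE] := xP _ (or_intror (or_intror erefl)).
have /= := xP _ (or_intror (or_introl erefl)); rewrite gE => -[].
by apply: Ff => h Fh; rewrite -gE; apply: xP; left.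
Qed.

(* The topology with basis of open sets [f] = {p | f \in p}. *)
Definition SG_open : set (set SG) :=
  [set U | forall p : SG, U p -> exists2 f, fmls p f & forall q : SG, fmls q f -> U q].

Fact SG_openT : SG_open setT.
Proof. by move=> p _; exists (G_formula N) => //; exact: fmls_G. Qed.

Fact SG_openI : setI_closed SG_open.
Proof.
move=> U V oU oV p [/oU[f pf fU] /oV[h ph hV]].
have f4 := fmls_in pf; have h4 := fmls_in ph.
exists (ord.And f h).
  apply: (@SG_closed p [set f; h]); first exact: finite_set2.
  - by move=> _ [->|->].
  - by move=> i /=; rewrite mem_cat => /orP[/f4|/h4].
  - by move=> x H /=; split; apply: H; [left|right].
move=> q qfh; have qfh4 := fmls_in qfh; split; [apply: fU|apply: hV].
  apply: (@SG_closed q [set ord.And f h]) => //; first by move=> _ ->.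
  by move=> x /(_ _ erefl)[].
apply: (@SG_closed q [set ord.And f h]) => //; first by move=> _ ->.
by move=> x /(_ _ erefl)[].
Qed.

Fact SG_open_bigU (I : Type) (U : I -> set SG) :
  (forall i, SG_open (U i)) -> SG_open (\bigcup_i U i).
Proof.
move=> oU p [i _ /oU[f pf fU]]; exists f => // q /fU Uq; by exists i.
Qed.

HB.instance Definition _ :=
  isOpenTopological.Build SG SG_openT SG_openI SG_open_bigU.

(* Left translation: g . tp(a) = tp(g * a), so f(x) belongs to g . p iff
   f(g * x) belongs to p. *)
Definition translate_fmls (g : G N) (p : SG) : set (ord.formula N) :=
  [set f | formulas_in 4 f /\ fmls p (lmul_formula g f)].

Fact translate_in g p : translate_fmls g p `<=` formulas_in 4.
Proof. by move=> f []. Qed.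

Fact translate_consistent g p : finitely_satisfiable 4 (translate_fmls g p).
Proof.
move=> F finF Fp.
have [||x xP] := @fmls_consistent p (lmul_formula g @` F `|` [set G_formula N]).
- by rewrite finite_setU; split; [exact: finite_image|exact: finite_set1].
- by move=> _ [[f /Fp[_ pf] <-]//|->]; exact: fmls_G.
have /holds_G[h hE] := xP _ (or_intror erefl).
exists (coords (g * h)%g) => f Ff; apply/holds_lmul; rewrite -hE.
by apply: xP; left; exists f.
Qed.

Fact translate_complete g p f : formulas_in 4 f ->
  translate_fmls g p f \/ translate_fmls g p (ord.Not f).
Proof.
move=> f4; have [pf|pNf] := fmls_complete p (lmul_formula_in (g := g) f4).
  by left.
by right.
Qed.

Fact translate_G g p : translate_fmls g p (G_formula N).
Proof.
have G4 : formulas_in 4 (G_formula N) by apply: (@fmls_in p); exact: fmls_G.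
split=> //; apply: (@SG_closed p set0) => //; first exact: lmul_formula_in.
by move=> x _; apply/holds_lmul/holds_G; exists (g * x)%g.
Qed.

Definition translate (g : G N) (p : SG) : SG :=
  MkSG (@translate_in g p) (@translate_consistent g p)
    (@translate_complete g p) (translate_G g p).

Definition orbit (p : SG) : set SG := [set translate g p | g in [set: G N]].

Definition invariant (X : set SG) :=
  forall (g : G N) (p : SG), X p -> X (translate g p).

Definition closed_invariant (X : set SG) :=
  [/\ X !=set0, closed X & invariant X].

Definition minimal_closed_invariant (X : set SG) :=
  closed_invariant X /\
  forall Y : set SG, closed_invariant Y -> Y `<=` X -> Y = X.

Definition almost_periodic : set SG :=
  [set p | minimal_closed_invariant (closure (orbit p))].

Definition translates_union (E Y : set (G N)) : set (G N) :=
  \bigcup_(g in E) [set (g * y)%g | y in Y].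

Definition left_generic (Y : set (G N)) :=
  exists E : set (G N), finite_set E /\ translates_union E Y = setT.

Definition weakly_generic_set (Y : set (G N)) :=
  exists E : set (G N), finite_set E /\ ~ left_generic (~` translates_union E Y).

Definition weakly_generic : set SG :=
  [set p | forall f, fmls p f ->
     weakly_generic_set [set x : G N | ord.holds (coords x) f]].

End Types.

Section Models.

Definition elementary_embedding (N M : rcfType) (iota : N -> M) :=
  forall (f : ord.formula N) (e : seq N),
    ord.holds e f <-> ord.holds (map iota e) (map_formula iota f).

(* |M|-saturation, for types in one variable over parameter sets A with
   |A| < |M|. *)
Definition saturated (M : rcfType) :=
  forall (A : set M) (p : set (ord.formula M)),
    ~~ ([set: M] #<= A)%card ->
    p `<=` formulas_in 1 ->
    p `<=` range (map_formula (set_val : A -> M)) ->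
    finitely_satisfiable 1 p ->
    exists x : M, forall f, p f -> ord.holds [:: x] f.

End Models.

(* Main.v *)
Require Import Defs.
From mathcomp Require Import all_boot all_order all_algebra.
From mathcomp Require Import all_classical all_reals topology.
From mathcomp Require Import ordered_qelim ring lra.

(* Almost periodic types are weakly generic by compactness: finitely many
   translates of a formula in the type cover its minimal orbit closure.

   Conversely, the sets that are not weakly generic form an ideal, so every
   directed family of weakly generic sets is contained in a weakly generic
   type.  Apply this to the sets of (z, (a, b)) with z close to 1, a large, b/a
   small and |z - 1|^2 a < b, where "close" and "small" range over rational
   bounds only, so that finitely many rotations of an arc cover the circle, even
   over a non-archimedean field.  A rotation by a standard amount moves z far
   away from any given finite set of points h, and then |z - h|^2 a exceeds b by
   an arbitrary amount.  Hence the orbit closure of the type p obtained meets the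
   closed invariant set "|z - h|^2 a - b > v for all h, v over N", which does not
   contain p: the orbit closure is not minimal. *)

Set Implicit Arguments.
Unset Strict Implicit.
Unset Printing Implicit Defensive.

Import Defs.
Import Order.TTheory GRing.Theory Num.Theory.

Local Open Scope ring_scope.
Local Open Scope classical_set_scope.

(** * Finite index sets *)

Lemma filter_finite_forall (T I : Type) (F : set_system T) {FF : Filter F}
    (D : set I) (P : I -> set T) : finite_set D ->
  (forall i, D i -> F (P i)) -> F [set x | forall i, D i -> P i x].
Proof.
move: D P; elim/Pchoice: I => I D P /finite_fsetP[X ->] FP.
exact: filter_bigI FP.
Qed.

Lemma finite_upper_bound (N : realDomainType) (I : Type) (D : set I)
  (phi : I -> N) : finite_set D -> exists B, forall i, D i -> phi i <= B.
Proof.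
elim/Pchoice: I D phi => I D phi; case/finite_seqP => s ->.
elim: s => [|i s [B HB]]; first by exists 0.
exists (Num.max (phi i) B) => j /=; rewrite inE le_max => /orP[/eqP->|js].
  by rewrite lexx.
by rewrite HB ?orbT.
Qed.

(** * The space of types and the translation action *)

Section TypeSpace.
Variable N : rcfType.
Implicit Types (f : ord.formula N) (p q : SG N) (g h x : G N).

Lemma G_formula_in : formulas_in 4 (G_formula N).
Proof. by move=> i; rewrite /= !inE => /orP[] /eqP->. Qed.

Lemma fmls_realized p (F : set (ord.formula N)) : finite_set F ->
  F `<=` fmls p -> exists x, forall f, F f -> ord.holds (coords x) f.
Proof.
move=> finF Fp; have [||y yP] := @fmls_consistent _ p (F `|` [set G_formula N]).
- by rewrite finite_setU; split=> //; exact: finite_set1.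
- by move=> f [/Fp//|->]; exact: fmls_G.
have /holds_G[x yE] := yP _ (or_intror erefl).
by exists x => f Ff; rewrite -yE; apply: yP; left.
Qed.

Lemma fmls_sub p f f' : fmls p f -> formulas_in 4 f' ->
  (forall x, ord.holds (coords x) f -> ord.holds (coords x) f') -> fmls p f'.
Proof.
move=> pf f4 ff; apply: (@SG_closed _ p [set f]) => //; first by move=> _ ->.
by move=> x xf; apply/ff/xf.
Qed.

Lemma fmls_not p f : formulas_in 4 f -> fmls p (ord.Not f) <-> ~ fmls p f.
Proof.
move=> f4; split=> [pNf pf|npf]; last by have [] := fmls_complete p f4.
have [||x xP] := @fmls_realized p [set f; ord.Not f].
- exact: finite_set2.
- by move=> _ [->|->].
by have /= := xP _ (or_intror erefl); apply; apply: xP; left.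
Qed.

(** One inclusion suffices because a complete consistent set of formulas is maximal. *)
Lemma SG_ext p q : (forall f, fmls p f -> fmls q f) -> p = q.
Proof.
move=> pq; have E : fmls p = fmls q.
  apply/seteqP; split=> // f qf; have f4 := fmls_in qf.
  by apply: contrapT => /(fmls_not p f4)/pq/(fmls_not q f4).
case: p q E {pq} => P a b c d [Q a' b' c' d'] /= E; subst Q.
by congr MkSG; exact: Prop_irrelevance.
Qed.

Lemma translateM g h p : translate g (translate h p) = translate (g * h)%g p.
Proof.
apply: SG_ext => f [f4 [_ pf]]; split=> //.
apply: (fmls_sub pf); first exact: lmul_formula_in.
by move=> x /holds_lmul /holds_lmul; rewrite mulgA => /holds_lmul.
Qed.

Lemma translate1 p : translate 1%g p = p.
Proof.
apply: SG_ext => f [f4 pf]; apply: (fmls_sub pf) => // x /holds_lmul.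
by rewrite mul1g.
Qed.

Definition basic f : set (SG N) := [set p | fmls p f].

Lemma open_basic f : open (basic f).
Proof. by move=> p pf; exists f. Qed.

Lemma basic_not f : formulas_in 4 f -> basic (ord.Not f) = ~` basic f.
Proof. by move=> f4; apply/seteqP; split=> p /(fmls_not p f4). Qed.

Lemma closed_basic f : formulas_in 4 f -> closed (basic f).
Proof.
move=> f4; rewrite -[basic f]setCK -basic_not //.
exact/open_closedC/open_basic.
Qed.

Lemma nbhs_basic p f : fmls p f -> nbhs p (basic f).
Proof. by move=> pf; apply: open_nbhs_nbhs; split=> //; exact: open_basic. Qed.

Lemma nbhs_SG p (B : set (SG N)) : nbhs p B ->
  exists2 f, fmls p f & basic f `<=` B.
Proof. by rewrite nbhsE => -[U [oU /oU[f pf fU]] UB]; exists f => // q /fU/UB. Qed.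

(** * Compactness, by limits of ultrafilters *)

Section UltraLimit.
Variables (U : set_system (SG N)) (UU : UltraFilter U).

Definition lim_fmls : set (ord.formula N) :=
  [set f | formulas_in 4 f /\ U (basic f)].

Fact lim_in : lim_fmls `<=` formulas_in 4. Proof. by move=> f []. Qed.

Fact lim_consistent : finitely_satisfiable 4 lim_fmls.
Proof.
move=> F finF FU.
have [q qF] : exists q, forall f, F f -> fmls q f.
  have : U [set q | forall f, F f -> basic f q].
    by apply: filter_finite_forall => // f /FU[].
  by move=> /filter_ex[q qF]; exists q.
by apply: (@fmls_consistent _ q).
Qed.

Fact lim_complete f : formulas_in 4 f -> lim_fmls f \/ lim_fmls (ord.Not f).
Proof.
move=> f4; rewrite /lim_fmls /= basic_not //.
by have [] := in_ultra_setVsetC (basic f) UU; [left|right].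
Qed.

Fact lim_G : lim_fmls (G_formula N).
Proof.
by split; [exact: G_formula_in|apply: filterE => q; exact: fmls_G].
Qed.

Definition ultra_lim : SG N :=
  MkSG lim_in lim_consistent lim_complete lim_G.

Lemma ultra_limP : U --> ultra_lim.
Proof. by move=> B /nbhs_SG[f [_ Uf] fB]; exact: filterS Uf. Qed.

End UltraLimit.

Lemma SG_compact : compact [set: SG N].
Proof.
by rewrite compact_ultra => U UU _; exists (ultra_lim UU); split=> //; exact: ultra_limP.
Qed.

(** Otherwise the sets [B D] generate a proper filter, which clusters at some [q] in [X]. Some [F i]
    belongs to [q], so [basic (F i)] would have to meet [B [set i]], which is disjoint from it. *)
Lemma SG_finite_cover (X : set (SG N)) (I : Type) (F : I -> ord.formula N) :
  closed X -> (forall q, X q -> exists i, fmls q (F i)) ->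
  exists2 D : set I, finite_set D &
    forall q, X q -> exists2 i, D i & fmls q (F i).
Proof.
move=> cX Xcov; apply: contrapT => noD.
pose B (D : set I) := [set q | X q /\ forall i, D i -> ~ fmls q (F i)].
pose UU := filter_from finite_set B.
have B_ne D : finite_set D -> B D !=set0.
  move=> finD; apply: contrapT => B0; apply: noD; exists D => // q Xq.
  apply: contrapT => qD; apply: B0; exists q; split=> // i Di qi.
  by apply: qD; exists i.
have UUF : ProperFilter UU.
  apply: filter_from_proper => //; apply: filter_from_filter.
    by exists set0.
  move=> D E finD finE; exists (D `|` E); first by rewrite finite_setU.
  by move=> q [Xq qDE]; split; split=> // i iD; apply: qDE; [left|right].
have [] := subclosed_compact cX SG_compact (@subsetT _ X) (F := UU).
  by exists set0 => // q [].
move=> q [/Xcov[i qi] /(_ _ _ _ (nbhs_basic qi))].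
by case/(_ (B [set i]))=> [|r [[_ /(_ i erefl)]]//]; exists [set i].
Qed.

(** * Orbit closures *)

Lemma orbit_translate g p : orbit p (translate g p).
Proof. by exists g. Qed.

Lemma orbit_self p : orbit p p.
Proof. by rewrite -{2}[p]translate1; exact: orbit_translate. Qed.

(** Translation is continuous: it pulls [basic f] back to [basic (lmul_formula g f)]. *)
Lemma closure_orbit_invariant p : invariant (closure (orbit p)).
Proof.
move=> g q pq B /nbhs_SG[f [f4 qf] fB].
have [_ [[h _ <-] phf]] := pq _ (nbhs_basic qf).
exists (translate (g * h)%g p); split; first exact: orbit_translate.
by apply: fB; rewrite -translateM.
Qed.

Lemma closure_orbit_closed_invariant p : closed_invariant (closure (orbit p)).
Proof.
split; [|exact: closed_closure|exact: closure_orbit_invariant].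
by exists p; apply: subset_closure; exact: orbit_self.
Qed.

Lemma closure_orbit_sub p (X : set (SG N)) :
  closed_invariant X -> X p -> closure (orbit p) `<=` X.
Proof.
move=> [_ cX iX] Xp; rewrite [X in _ `<=` X](closure_id X).1//.
by apply: closureS => _ [g _ <-]; exact: iX.
Qed.

Lemma almost_periodic_weakly_generic p : almost_periodic p -> weakly_generic p.
Proof.
move=> [ciX minX] f pf; set X := closure (orbit p) in ciX minX.
have [_ cX iX] := ciX; have f4 := fmls_in pf.
have Xp : X p by apply: subset_closure; exact: orbit_self.
have [|D finD Dcov] := SG_finite_cover cX (F := fun g => lmul_formula g f).
  move=> q Xq.
  (* By minimality the orbit closure of [q] is all of [X], so it contains [p], and some translate of
     [q] contains [f]. *)
  have XE := minX _ (closure_orbit_closed_invariant q) (closure_orbit_sub ciX Xq).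
  move: Xp; rewrite -XE => /(_ _ (nbhs_basic pf)) [_ [[g _ <-] [_ qf]]].
  by exists g.
(* [lmul_formula g f] defines the translate by [g^-1] of the set defined by [f], hence the
   inverses. *)
exists [set g^-1%g | g in D]; split; first exact: finite_image.
move=> [E [finE EG]].
have cov g : exists k, D k /\ fmls p (lmul_formula (k * g)%g f).
  have [k Dk kf] := Dcov _ (iX g _ Xp).
  exists k; split=> //; have : fmls (translate (k * g)%g p) f.
    by rewrite -translateM.
  by case.
have [k kP] := choice cov.
(* For every [g] in [E], such an [x] has [g^-1 * x] in one of the chosen translates, so no translate
   by [E] of their complement contains [x]. *)
have [||x xP] := @fmls_realized p [set lmul_formula (k g^-1%g * g^-1)%g f | g in E].
- exact: finite_image.
- by move=> _ [g _ <-]; case: (kP g^-1%g).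
have [g Eg [y yN gy]] : translates_union E
    (~` translates_union [set g^-1%g | g in D] [set x | ord.holds (coords x) f]) x.
  by rewrite EG.
have /holds_lmul := xP _ (ex_intro2 _ _ g Eg erefl).
rewrite -gy -mulgA mulKg => kyf; apply: yN; exists (k g^-1%g)^-1%g.
  by exists (k g^-1%g) => //; case: (kP g^-1%g).
by exists (k g^-1%g * y)%g; rewrite ?mulKg.
Qed.

End TypeSpace.

(** * The ideal of sets that are not weakly generic, and types avoiding it *)

Section WeakGenericity.
Variable N : rcfType.
Implicit Types (A B E Y : set (G N)).

Lemma translates_unionS E A B :
  A `<=` B -> translates_union E A `<=` translates_union E B.
Proof. by move=> AB x [g Eg [y Ay <-]]; exists g => //; exists y => //; apply: AB. Qed.

Lemma translates_unionM E E' Y :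
  translates_union E (translates_union E' Y)
  = translates_union [set (g * h)%g | g in E & h in E'] Y.
Proof.
apply/seteqP; split=> [_ [g Eg [_ [h Eh [y Yy <-]] <-]]|_ [_ [g Eg [h Eh <-]] [y Yy <-]]].
  by exists (g * h)%g; [exists g => //; exists h|exists y; rewrite ?mulgA].
exists g => //; exists (h * y)%g; last by rewrite mulgA.
by exists h => //; exists y.
Qed.

Lemma left_genericS A B : A `<=` B -> left_generic A -> left_generic B.
Proof.
move=> AB [E [finE EA]]; exists E; split=> //; apply/seteqP; split=> // x _.
by apply: (translates_unionS AB); rewrite EA.
Qed.

Lemma left_generic_translates E A : finite_set E ->
  left_generic (translates_union E A) -> left_generic A.
Proof.
move=> finE [F [finF FE]]; exists [set (g * h)%g | g in F & h in E].
by split; [exact: finite_image2|rewrite -translates_unionM].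
Qed.

Lemma weakly_genericS A B :
  A `<=` B -> weakly_generic_set A -> weakly_generic_set B.
Proof.
move=> AB [E [finE nE]]; exists E; split=> //; apply: contra_not nE.
by apply: left_genericS; apply: subsetC; exact: translates_unionS.
Qed.

(** The complement of [E A] lies in the union of [E B] and [C]. If this union is not generic, [E]
    witnesses that [A] is weakly generic. If its translates by [F] cover the group, the complement
    of [F E B] lies in [F C], which is not generic since [C] is not; so the products of [F] and [E]
    serve for [B]. *)
Lemma weakly_genericU A B : weakly_generic_set (A `|` B) ->
  weakly_generic_set A \/ weakly_generic_set B.
Proof.
move=> [E [finE nC]]; set C := ~` _ in nC.
have [|nEBC] := pselect (left_generic (translates_union E B `|` C)); last first.
  left; exists E; split=> //; apply: contra_not nEBC; apply: left_genericS.
  move=> x nxA; have [xB|nxB] := pselect (translates_union E B x); first by left.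
  right=> -[g Eg [y [Ay|By] yx]].
    by apply: nxA; exists g => //; exists y.
  by apply: nxB; exists g => //; exists y.
move=> [F [finF FG]]; right.
exists [set (g * h)%g | g in F & h in E]; split; first exact: finite_image2.
apply: contra_not nC => gen; apply: (left_generic_translates finF).
apply: left_genericS gen => x; rewrite -translates_unionM => nx.
have [g Fg [y [yB|yC] yx]] : translates_union F (translates_union E B `|` C) x.
- by rewrite FG.
- by case: nx; exists g => //; exists y.
- by exists g => //; exists y.
Qed.

(* The filter of the sets containing some [B i] up to a set that is not weakly
   generic; any ultrafilter above it will do. *)
Lemma weakly_generic_ultrafilter (I : Type) (B : I -> set (G N)) (i0 : I) :
  (forall i j, exists k, B k `<=` B i `&` B j) ->
  (forall i, weakly_generic_set (B i)) ->
  exists U : set_system (G N), [/\ UltraFilter U, forall i, U (B i) &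
    forall Y, U Y -> weakly_generic_set Y].
Proof.
move=> dirB wgB.
pose F Y := exists i, ~ weakly_generic_set (B i `\` Y).
have wg0 : ~ weakly_generic_set (set0 : set (G N)).
  move=> [E [_]]; apply; exists [set 1%g]; split; first exact: finite_set1.
  apply/seteqP; split=> // x _; exists 1%g => //; exists x; last by rewrite mul1g.
  by move=> [g _ [y []]].
have FF : ProperFilter F.
  split.
    by move=> [i]; rewrite setD0; apply.
  split.
  - by exists i0; rewrite setDT.
  - move=> P Q [i nP] [j nQ]; have [k kij] := dirB i j; exists k => wg.
    have : weakly_generic_set ((B i `\` P) `|` (B j `\` Q)).
      apply: weakly_genericS wg => x [/kij[Bi Bj] nPQ].
      have [Px|nPx] := pselect (P x); last by left.
      by right; split=> // Qx; apply: nPQ.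
    by case/weakly_genericU.
  - move=> P Q PQ [i nP]; exists i; apply: contra_not nP.
    by apply: weakly_genericS => x [Bi nQ]; split=> // /PQ.
have [U [UU FU]] := ultraFilterLemma FF.
exists U; split=> // [i|Y UY]; first by apply: FU; exists i; rewrite setDv.
apply: contrapT => nY; have UnY : U (~` Y).
  by apply: FU; exists i0; apply: contra_not nY; apply: weakly_genericS => x [_ /contrapT].
by have [x []] := filter_ex (filterI UY UnY).
Qed.

Section Realized.
Variable x : G N.

Definition realized_fmls : set (ord.formula N) :=
  [set f | formulas_in 4 f /\ ord.holds (coords x) f].

Fact realized_in : realized_fmls `<=` formulas_in 4. Proof. by move=> f []. Qed.

Fact realized_consistent : finitely_satisfiable 4 realized_fmls.
Proof. by move=> F _ Fx; exists (coords x) => f /Fx[]. Qed.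

Fact realized_complete f :
  formulas_in 4 f -> realized_fmls f \/ realized_fmls (ord.Not f).
Proof. by move=> f4; have [] := pselect (ord.holds (coords x) f); [left|right]. Qed.

Fact realized_G : realized_fmls (G_formula N).
Proof. by split; [exact: G_formula_in|apply/holds_G; exists x]. Qed.

Definition realized_type : SG N :=
  MkSG realized_in realized_consistent realized_complete realized_G.

End Realized.

(** An ultrafilter on the group is pushed to the space of types by [realized_type], and [p] is a
    cluster point of the image. Speaking of the formulas implied by [B i] avoids writing [B i]
    itself as a formula. *)
Lemma weakly_generic_type (I : Type) (B : I -> set (G N)) (i0 : I) :
  (forall i j, exists k, B k `<=` B i `&` B j) ->
  (forall i, weakly_generic_set (B i)) ->
  exists2 p : SG N, weakly_generic p & forall f i, formulas_in 4 f ->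
    (forall x, B i x -> ord.holds (coords x) f) -> fmls p f.
Proof.
move=> dirB /(weakly_generic_ultrafilter i0 dirB)[U [UU UB Uwg]].
have [p [_ clp]] : [set: SG N] `&` cluster (realized_type @ U) !=set0.
  by apply: SG_compact; exact: filterT.
(* If the negation of [f] held on a set of [U], the image of [U] would contain the complement of
   [basic f], a neighbourhood of [p]. *)
have pU f : fmls p f -> U [set x | ord.holds (coords x) f].
  move=> pf; have f4 := fmls_in pf.
  have [//|Unf] := in_ultra_setVsetC [set x | ord.holds (coords x) f] UU.
  have [q [nqf qf]] : ~` basic f `&` basic f !=set0.
    apply: clp (nbhs_basic pf).
    suff : U (realized_type @^-1` (~` basic f)) by [].
    by apply: filterS Unf => x nxf xf; apply: nxf; case: xf.
  by [].
exists p => [f /pU/Uwg//|f i f4 Bf].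
apply: contrapT => /(fmls_not p f4)/pU Unf.
by have [x [/Bf xf]] := filter_ex (filterI (UB i) Unf); apply.
Qed.

End WeakGenericity.

(** * Nets and separation on the circle, with rational constants *)

Section Circle.
Variable N : rcfType.
Implicit Types (z w y h : circle N) (g x : G N) (n k : nat).

Lemma circleE z : (val z).1 ^+ 2 + (val z).2 ^+ 2 = 1.
Proof. exact/eqP/(valP z). Qed.

(* Half the squared Euclidean distance; being polynomial, it can be used in
   formulas. *)
Definition dist z w : N :=
  1 - ((val z).1 * (val w).1 + (val z).2 * (val w).2).

Lemma distE z w :
  2 * dist z w = ((val z).1 - (val w).1) ^+ 2 + ((val z).2 - (val w).2) ^+ 2.
Proof. by have := circleE z; have := circleE w; rewrite /dist; lra. Qed.

Lemma dist_ge0 z w : 0 <= dist z w.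
Proof.
by have := distE z w; have := sqr_ge0 ((val z).1 - (val w).1);
  have := sqr_ge0 ((val z).2 - (val w).2); lra.
Qed.

Lemma dist_le2 z w : dist z w <= 2.
Proof.
by have := circleE z; have := circleE w; have := sqr_ge0 ((val z).1 + (val w).1);
  have := sqr_ge0 ((val z).2 + (val w).2); rewrite /dist; lra.
Qed.

(** The parallelogram law for [z - w] and [w - y], whose difference is [z - 2 w + y]; squaring
    distances costs the factor 2. *)
Lemma dist_triangle z w y : dist z y <= 2 * (dist z w + dist w y).
Proof.
have := distE z w; have := distE w y; have := distE z y.
have := sqr_ge0 ((val z).1 - 2 * (val w).1 + (val y).1).
have := sqr_ge0 ((val z).2 - 2 * (val w).2 + (val y).2).
by lra.
Qed.

Lemma dist_mul z w h : dist (circle_mul z w) h = dist w (circle_mul (circle_inv z) h).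
Proof. by rewrite /dist /=; ring. Qed.

Lemma dist_mul1 z w : dist z (circle_mul z w) = dist w (circle_one N).
Proof.
transitivity (1 - ((val z).1 ^+ 2 + (val z).2 ^+ 2) * (val w).1).
  by rewrite /dist /=; ring.
by rewrite circleE /dist /=; ring.
Qed.

(** As [dist] is quadratic, [eps n] matches coordinate errors of order [2^-1 ^+ n]. *)
Definition eps n : N := 4^-1 ^+ n.

Lemma eps_gt0 n : 0 < eps n.
Proof. by rewrite exprn_gt0 // invr_gt0 ltr0n. Qed.

Lemma epsS n : eps n = 4 * eps n.+1.
Proof. by rewrite /eps exprS; field. Qed.

Lemma eps_le n k : (n <= k)%N -> eps k <= eps n.
Proof. by move=> nk; apply: ler_wiXn2l => //; lra. Qed.

(** Bisection: each centre is replaced by two, so the net stays finite over any ordered field. *)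
Lemma interval_net n : exists s : seq N, forall a, -1 <= a <= 1 ->
  exists2 c, c \in s & `|a - c| <= 2^-1 ^+ n.
Proof.
elim: n => [|n [s sP]].
  exists [:: 0] => a a1; exists 0; first exact: mem_head.
  by rewrite subr0 expr0 ler_norml.
set r := 2^-1 ^+ n.+1; have rE : 2^-1 ^+ n = 2 * r by rewrite /r exprS; field.
exists ([seq c - r | c <- s] ++ [seq c + r | c <- s]) => a /sP[c cs].
rewrite rE ler_norml => /andP[h1 h2]; have [ac|ca] := leP a c.
  exists (c - r); first by rewrite mem_cat; apply/orP; left; apply/mapP; exists c.
  by rewrite ler_norml; apply/andP; split; lra.
exists (c + r); first by rewrite mem_cat; apply/orP; right; apply/mapP; exists c.
by rewrite ler_norml; apply/andP; split; lra.
Qed.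

Lemma ler_sqr_norm (a r : N) : 0 <= r -> (a ^+ 2 <= r ^+ 2) = (`|a| <= r).
Proof. by move=> r0; rewrite -(real_normK (num_real a)) ler_pXn2r ?nnegrE. Qed.

Lemma circle_coord_bounds z :
  -1 <= (val z).1 <= 1 /\ -1 <= (val z).2 <= 1.
Proof.
have := circleE z; have := sqr_ge0 (val z).1; have := sqr_ge0 (val z).2.
by split; rewrite -ler_norml -ler_sqr_norm //; lra.
Qed.

Lemma circle_net n : exists2 E : set (circle N), finite_set E &
  forall z, exists2 e, E e & dist z e < eps n.
Proof.
(* Points of one cell differ by at most [2 * r] in each coordinate, so their [dist] is at most
   [4 * r ^+ 2 = eps n.+1]. *)
have [s sP] := interval_net n.+2; set r := 2^-1 ^+ n.+2 in sP.
have r0 : 0 < r by rewrite exprn_gt0 // invr_gt0 ltr0n.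
have rE : r ^+ 2 = eps n.+2.
  by rewrite /r /eps -exprM mulnC exprM; congr (_ ^+ _); field.
pose cell (c d : N) : set (circle N) :=
  [set e | `|(val e).1 - c| <= r /\ `|(val e).2 - d| <= r].
(* One point of the circle is chosen in each cell; the default is taken only for empty cells, which
   contain no [z]. *)
exists [set xget (circle_one N) (cell c d) | c in [set` s] & d in [set` s]].
  exact: finite_image2.
move=> z; have [/sP[c cs zc] /sP[d ds zd]] := circle_coord_bounds z.
exists (xget (circle_one N) (cell c d)); first by exists c => //; exists d.
have [] : cell c d (xget (circle_one N) (cell c d)).
  by apply: xgetPex; exists z.
set e := xget _ _ => ec ed.
have d1 : ((val z).1 - (val e).1) ^+ 2 <= (2 * r) ^+ 2.
  by rewrite ler_sqr_norm; [move: zc ec; rewrite !ler_norml|]; lra.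
have d2 : ((val z).2 - (val e).2) ^+ 2 <= (2 * r) ^+ 2.
  by rewrite ler_sqr_norm; [move: zd ed; rewrite !ler_norml|]; lra.
have := distE z e; have := epsS n; have := epsS n.+1; have := eps_gt0 n.+2.
by rewrite -rE; lra.
Qed.

(** To avoid one more point, the interval is cut into quarters and the first or the last is kept,
    whichever is at least a quarter away from it. Keeping an interval lets the induction
    continue. *)
Lemma avoid_points (s : seq N) : exists k c, [/\ 0 <= c, c + eps k <= 1 &
  forall a b, a \in s -> c <= b <= c + eps k -> eps k <= `|b - a|].
Proof.
elim: s => [|a s [k [c [c0 c1 cs]]]].
  by exists 0%N, 0; split=> //; rewrite /eps expr0 add0r.
have eE := epsS k; have e0 := eps_gt0 k.+1.
exists k.+1; have [ac|ca] := leP a (c + 2 * eps k.+1).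
  exists (c + 3 * eps k.+1); split; [lra|lra|].
  move=> a' b; rewrite inE => /orP[/eqP->|a's] /andP[b1 b2].
    by rewrite ger0_norm; lra.
  apply: (le_trans _ (cs _ _ a's _)); first by lra.
  by apply/andP; split; lra.
exists c; split; [lra|lra|].
move=> a' b; rewrite inE => /orP[/eqP->|a's] /andP[b1 b2].
  by rewrite ler0_norm; lra.
apply: (le_trans _ (cs _ _ a's _)); first by lra.
by apply/andP; split; lra.
Qed.

Lemma circle_avoid (D : set (circle N)) : finite_set D ->
  exists k z, forall h, D h -> eps k <= dist z h.
Proof.
move=> finD; have := finite_image (fun h => (val h).1) finD.
case/finite_seqP => s sE; have [k [c [c0 c1 cs]]] := avoid_points s.
have e0 := eps_gt0 k.
have c2 : c ^+ 2 <= 1 by rewrite -[leRHS](expr1n N 2) ler_sqr_norm // ger0_norm //; lra.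
have zP : c ^+ 2 + Num.sqrt (1 - c ^+ 2) ^+ 2 == 1.
  by rewrite sqr_sqrtr ?subr_ge0 // addrC subrK.
(* Separating first coordinates is enough: [2 * dist] is at least [eps k ^+ 2 = eps (k + k)], and
   the successor absorbs the factor 2. *)
exists (k + k).+1, (exist _ (c, Num.sqrt (1 - c ^+ 2)) zP) => h Dh.
have hs : (val h).1 \in s.
  have : [set (val h).1 | h in D] (val h).1 by exists h.
  by rewrite sE.
have := distE (exist _ (c, Num.sqrt (1 - c ^+ 2)) zP) h; rewrite /=.
have := cs _ c hs; rewrite lexx lerDl ltW //= => /(_ isT) kc.
have : eps k ^+ 2 <= (c - (val h).1) ^+ 2.
  by rewrite -[leRHS]real_normK ?num_real // lerXn2r ?nnegrE // ltW.
have := sqr_ge0 (Num.sqrt (1 - c ^+ 2) - (val h).2).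
have := epsS (k + k); have := eps_gt0 (k + k).+1.
have : eps (k + k) = eps k ^+ 2 by rewrite /eps exprD expr2.
by lra.
Qed.

End Circle.

(** * A weakly generic type that is not almost periodic *)

Section Separation.
Variable N : rcfType.
Implicit Types (z h : circle N) (g x : G N) (n : nat) (K v : N).

(** The absolute value keeps [x.2.1] positive for every index. *)
Definition cone (i : nat * N) : set (G N) :=
  [set x | [/\ `|i.2| < x.2.1, dist x.1 (circle_one N) < eps N i.1,
    x.2.2 < eps N i.1 * x.2.1 & dist x.1 (circle_one N) * x.2.1 < x.2.2]].

Lemma cone_directed i j : exists k, cone k `<=` cone i `&` cone j.
Proof.
case: i j => n K [m L]; exists (maxn n m, `|K| + `|L|) => x [/=].
rewrite ger0_norm ?addr_ge0 // => xK d1 d2 d3.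
have K0 := normr_ge0 K; have L0 := normr_ge0 L.
have x0 : 0 <= x.2.1 by lra.
have nm := eps_le N (leq_maxl n m); have mn := eps_le N (leq_maxr n m).
have := ler_wpM2r x0 nm; have := ler_wpM2r x0 mn.
by split; split=> //=; lra.
Qed.

(** Rotating by a net removes the condition on the circle, leaving at least the wedge where [x.2.1]
    is large and [x.2.2 / x.2.1] is between [eps n.+1] and [eps n]. A finite set of shifts cannot
    move a point deep inside the wedge out of it. *)
Lemma cone_weakly_generic i : weakly_generic_set (cone i).
Proof.
case: i => n K; have [E finE EP] := circle_net N n.+1.
exists [set ((z, (0, 0)) : G N) | z in E]; split; first exact: finite_image.
move=> [F [finF FG]]; have e0 := eps_gt0 N n.+1; have eE := epsS N n.
(* The 4 is the ratio of the slopes [eps n] and [eps n.+1] of the wedge; the division puts vertical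
   shifts on the scale of [a]. *)
have [B BP] := finite_upper_bound
  (fun g : G N => `|g.2.1| * 4 + `|g.2.2| / eps N n.+1) finF.
pose a := `|K| + 1 + `|B|; pose x : G N := (circle_one N, (a, 2 * eps N n.+1 * a)).
have [g Fg [y yN yx]] : translates_union F
    (~` translates_union [set ((z, (0, 0)) : G N) | z in E] (cone (n, K))) x.
  by rewrite FG.
apply: yN; have [e Ee ye] := EP y.1.
exists (e, (0, 0)); first by exists e.
have yE : y = (g^-1 * x)%g by rewrite -yx mulKg.
have y1 : y.2.1 = a - g.2.1 by rewrite yE /= addrC.
have y2 : y.2.2 = 2 * eps N n.+1 * a - g.2.2 by rewrite yE /= addrC.
exists (((e, (0, 0)) : G N)^-1 * y)%g; last by rewrite mulVKg.
have dE : dist (circle_mul (circle_inv e) y.1) (circle_one N) = dist y.1 e.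
  by rewrite /dist /=; ring.
have /= := BP g Fg; have := normr_ge0 K; have := ler_norm B.
have := ler_norm g.2.1; have := ler_norm (- g.2.1); rewrite normrN.
have := ler_norm g.2.2; have := ler_norm (- g.2.2); rewrite normrN.
set v := `|g.2.2|; set w := v / _ => v1 v2 u1 u2 B1 K0 gB.
have vE : v = w * eps N n.+1 by rewrite /w divfK // gt_eqF.
have w0 : 0 <= w := divr_ge0 (normr_ge0 _) (ltW e0).
have aK : `|K| + 1 + 4 * `|g.2.1| + w <= a by rewrite /a; lra.
have := ler_wpM2r (ltW e0) aK; have := mulr_ge0 K0 (ltW e0).
have := ler_wpM2r (ltW e0) u1; have := ler_wpM2r (ltW e0) u2 => eu1 eu2 eK eaK.
have ya : `|K| < y.2.1 by rewrite y1; have := normr_ge0 g.2.1; lra.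
have yy : dist y.1 e * y.2.1 <= eps N n.+1 * y.2.1.
  by rewrite ler_wpM2r ?(ltW ye) // ltW // (le_lt_trans K0 ya).
split; rewrite ?dE /= ?oppr0 ?add0r //=; first by lra.
  by rewrite y1 y2 eE; lra.
by apply: (le_lt_trans yy); rewrite y1 y2; lra.
Qed.

Definition far_formula (i : circle N * N) : ord.formula N :=
  let: (h, v) := i in
  ord.Lt v%:T%T ((1 - ('X_0 * ((val h).1)%:T + 'X_1 * ((val h).2)%:T)) * 'X_2
                 - 'X_3)%T.

Lemma far_formula_in i : formulas_in 4 (far_formula i).
Proof. by case: i => h v j; rewrite /= !inE => /or4P[] /eqP->. Qed.

Lemma holds_far h v x :
  ord.holds (coords x) (far_formula (h, v)) <-> v < dist x.1 h * x.2.1 - x.2.2.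
Proof. by []. Qed.

Definition far : set (SG N) := [set p | forall i, fmls p (far_formula i)].

Lemma closed_far : closed far.
Proof.
have -> : far = \bigcap_i basic (far_formula i).
  by apply/seteqP; split=> p pf i => [_|]; exact: pf.
by apply: closed_bigI => i _; apply: closed_basic; exact: far_formula_in.
Qed.

Lemma invariant_far : invariant far.
Proof.
move=> g p pfar [h v]; split; first exact: far_formula_in.
(* Rotation moves [h]. The shift by [g.2] changes the value by a bounded amount because [dist] is at
   most 2, and the new [v] compensates. *)
apply: (fmls_sub (pfar (circle_mul (circle_inv g.1) h, v + g.2.2 + 2 * `|g.2.1|))).
  by apply: lmul_formula_in; exact: far_formula_in.
move=> x /holds_far xfar; apply/holds_lmul/holds_far.
rewrite /= dist_mul; set d := dist _ _ in xfar *.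
have d0 : 0 <= d := dist_ge0 _ _; have d2 : d <= 2 := dist_le2 _ _.
have : - (2 * `|g.2.1|) <= d * g.2.1.
  rewrite lerNl -mulrN; apply: le_trans (ler_norm _) _.
  by rewrite normrM normrN ger0_norm // ler_wpM2r.
by rewrite mulrDr; lra.
Qed.

Lemma closure_orbit_meets_far p :
  (forall f i, formulas_in 4 f ->
     (forall x, cone i x -> ord.holds (coords x) f) -> fmls p f) ->
  exists2 q, closure (orbit p) q & far q.
Proof.
move=> pcone; apply: contrapT => nofar.
have [|D finD Dcov] := SG_finite_cover (X := closure (orbit p))
    (F := fun i => ord.Not (far_formula i)) (@closed_closure _ _).
  move=> q pq; apply: contrapT => qfar; apply: nofar; exists q => // i.
  apply: contrapT => /(fmls_not q (@far_formula_in i)) qi.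
  by apply: qfar; exists i.
have [k [z zP]] := circle_avoid (finite_image fst finD).
(* Then [x.2.1 > B] makes every [v] in play smaller than [eps k.+2 * x.2.1]. *)
have [B BP] := finite_upper_bound
  (fun i : circle N * N => `|i.2| / eps N k.+2) finD.
pose g : G N := (z, (0, 0)).
have [|[h v] Dhv [_]] := Dcov (translate g p).
  by apply: subset_closure; exact: orbit_translate.
have hv4 := lmul_formula_in (g := g) (@far_formula_in (h, v)).
move=> /(fmls_not p hv4); apply.
apply: (pcone _ (k.+2, B) hv4) => x [xB d1 b1 _].
apply/holds_lmul/holds_far; rewrite /= !add0r; move: xB d1 b1 => /= xB d1 b1.
have zh : eps N k <= dist z h by apply: zP; exists (h, v).
have := dist_triangle z (circle_mul z x.1) h; rewrite dist_mul1 => tri.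
have e0 := eps_gt0 N k.+2; have := epsS N k; have := epsS N k.+1 => e1 e2.
have x0 : 0 <= x.2.1 by rewrite ltW // (le_lt_trans _ xB).
have vB : `|v| < x.2.1 * eps N k.+2.
  rewrite -ltr_pdivrMr //; apply: le_lt_trans xB.
  exact: le_trans (BP _ Dhv) (ler_norm B).
(* With [e = eps k.+2], the triangle inequality gives [16 e <= 2 (e + dist)]. Of the resulting
   [7 e], [2 e] suffices: one [e] outweighs [x.2.2], the other [v]. *)
have d7 : 2 * eps N k.+2 <= dist (circle_mul z x.1) h by lra.
have := ler_wpM2r x0 d7; have := ler_norm v; lra.
Qed.

Lemma weakly_generic_not_almost_periodic :
  exists2 p : SG N, weakly_generic p & ~ almost_periodic p.
Proof.
have [p wgp pcone] :=
  weakly_generic_type (0%N, 0) cone_directed cone_weakly_generic.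
exists p => // -[_ minp].
have [q pq qfar] := closure_orbit_meets_far pcone.
have E : closure (orbit p) `&` far = closure (orbit p).
  apply: minp; last by move=> r [].
  split; first by exists q.
    by apply: closedI; [exact: closed_closure|exact: closed_far].
  by move=> g r [pr rfar]; split;
    [exact: closure_orbit_invariant|exact: invariant_far].
have : (closure (orbit p) `&` far) p.
  by rewrite E; apply: subset_closure; exact: orbit_self.
have far4 := @far_formula_in (circle_one N, 0).
move=> [_ /(_ (circle_one N, 0))]; apply/(fmls_not p far4).
(* The last condition of the cone contradicts the far formula at the identity with bound 0. *)
apply: (pcone _ (0%N, 0)) => // x [_ _ _ xb] /holds_far; lra.
Qed.

End Separation.

Theorem theorem1p3 (R : realType) :
  (@almost_periodic R `<` @weakly_generic R) /\
  (forall (M : rcfType) (iota : R -> M),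
     elementary_embedding iota -> saturated M ->
     @almost_periodic M `<` @weakly_generic M).
Proof.
have all (N : rcfType) : @almost_periodic N `<` @weakly_generic N.
  split; first exact: almost_periodic_weakly_generic.
  have [p wgp nap] := weakly_generic_not_almost_periodic N.
  by move=> /(_ p wgp).
by split=> [|M iota _ _]; exact: all.
Qed.
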